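(* Let $k$ be a positive integer and let $p$ be a prime with $p\equiv 5 \pmod 6$. Let $r$ be a non-negative integer such that $p$ divides $6r+5$. Then for all integers $n\geq 0$, $$\bar{B}_{2,9}\left(6p^{k+1}n+6pr+5p\right)\equiv (-p)\cdot \bar{B}_{2,9}\left(6p^{k-1}n+\frac{6r+5}{p}\right) \pmod 8.$$
   Context: An overpartition of a positive integer $n$ is a partition of $n$ in which the first occurrence of each distinct part may be overlined. For coprime integers $\ell_1,\ell_2>1$, $\bar{B}_{\ell_1,\ell_2}(n)$ denotes the number of overpartitions of $n$ in which no part is divisible by $\ell_1$ or by $\ell_2$, with $\bar{B}_{\ell_1,\ell_2}(0)=1$. *)

(* Defs.v *)
From mathcomp Require Import all_boot.

Set Implicit Arguments.
Unset Strict Implicit.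
Unset Printing Implicit Defensive.

(* A sequence of parts in weakly decreasing order; the boolean attached to a
   part records whether that occurrence is overlined, which is only permitted
   at the first occurrence of each part. *)
Definition is_overpartition (n : nat) (s : seq (nat * bool)) : bool :=
  let parts := unzip1 s in
  [&& sorted geq parts,
      all (leq 1) parts,
      sumn parts == n
    & all (fun i => (nth (0, false) s i).2
                      ==> (nth 0 parts i \notin take i parts))
          (iota 0 (size s))].

(* An overpartition of n has at most n parts, each at most n, so all of them
   occur among the bounded sequences below; this only serves to obtain a
   finite type to count in. *)
Definition overpartitions (n : nat) : {set {bseq n of 'I_n.+1 * bool}} :=
  [set t : {bseq n of 'I_n.+1 * bool} |
    is_overpartition n [seq (val x.1, x.2) | x <- t]].

Definition Bbar (l1 l2 n : nat) : nat :=
  #|[set t in overpartitions n |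
      all (fun x : 'I_n.+1 * bool => ~~ (l1 %| x.1) && ~~ (l2 %| x.1)) t]|.

(* Main.v *)
Require Import Defs.
From mathcomp Require Import all_boot all_order all_algebra.
From mathcomp Require Import zify ring.
Import GRing.Theory.

(** If [N] is congruent to 1 modulo 6 then [Bbar 2 9 N] is congruent to
    [2 * sigma N] modulo 8. Indeed the generating function is the product over
    the admissible parts [d] of [1 + 2 g_d] with [g_d = q^d + q^2d + ...], and
    modulo 8 this is [1 + 2 G + 2 (G^2 - sum_d g_d^2)] with [G = sum_d g_d].
    The coefficients of [q^N] in [G] and in [sum_d g_d^2] are [tau N] and
    [sigma N - tau N]. The one in [G^2] is a multiple of 4: it is the sum of
    the [G_i G_j] with [i + j = N], which come in pairs since [N] is odd, and
    each of them is even, because either 3 divides [i] or [j] (pair the divisors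
    [d] and [3 d]), or both are 2 modulo 3 (pair the divisors [d] and [i / d] for
    the odd one of the two).

    The theorem compares [Bbar 2 9] at [p^2 N] and at [N], and
    [sigma (p^2 N) + p sigma N = (p + 1) sigma (p N)], where [p + 1] is even,
    and so is [sigma (p N)] because [p N] is 5 modulo 6, hence odd and not a
    square. *)

Set Implicit Arguments.
Unset Strict Implicit.
Unset Printing Implicit Defensive.

(** * Overpartitions as chains, enumerated by their first part *)

Definition ovrel (x y : nat * bool) : bool :=
  (y.1 < x.1) || ((y.1 == x.1) && ~~ y.2).

Lemma ovrel_trans : transitive ovrel.
Proof.
move=> [b y] [a x] [c z]; rewrite /ovrel /=.
by case: x y z => [] [] [] /=; rewrite ?andbT ?andbF; lia.
Qed.

Lemma path_ovrel v b c s : path ovrel (v, b) s = path ovrel (v, c) s.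
Proof. by case: s. Qed.

(** Equal parts are adjacent in a weakly decreasing sequence, so an overlined entry is a first
    occurrence exactly when its predecessor, if any, is strictly larger. This makes the condition on
    marks local, which a recursion on the first part needs. *)
Lemma is_overpartitionE n s :
  is_overpartition n s =
  [&& sorted ovrel s, all (leq 1) (unzip1 s) & sumn (unzip1 s) == n].
Proof.
rewrite /is_overpartition /=.
set M := all _ (iota _ _).
suff -> : sorted ovrel s = sorted geq (unzip1 s) && M.
  by case: sorted; case: (all (leq 1) _); case: (_ == n); case: M.
have nthE i : i < size s -> nth 0 (unzip1 s) i = (nth (0, false) s i).1.
  by move=> lt_i; rewrite (nth_map (0, false)).
apply/idP/andP => [s_sorted | [/(sortedP 0) geq_s /allP marks]]; last first.
  apply/(sortedP (0, false)) => i lt_i; have lt_i' := ltnW lt_i.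
  have := geq_s i; rewrite size_map => /(_ lt_i); rewrite !nthE // /ovrel /geq /=.
  rewrite leq_eqVlt => /orP[/eqP eq_i | ->//].
  have /marks : i.+1 \in iota 0 (size s) by rewrite mem_iota.
  rewrite nthE // eq_i eqxx ltnn /= implybN => /implyP; apply.
  rewrite -nthE //; apply/(nthP 0); exists i; last by rewrite nth_take.
  by rewrite size_take size_map lt_i.
split.
  rewrite sorted_map; apply: sub_sorted s_sorted => x y /=.
  by rewrite /ovrel /relpre /=; case: y.2; lia.
apply/allP => i; rewrite mem_iota add0n => /= lt_i; apply/implyP => mark_i.
apply/negP => /(nthP 0)[j]; rewrite size_take size_map lt_i => lt_ji.
rewrite nth_take // !nthE ?(ltn_trans lt_ji) // => eq_ji.
have := sorted_ltn_nth ovrel_trans (0, false) s_sorted.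
move=> /(_ j i); rewrite !inE (ltn_trans lt_ji) // => /(_ isT lt_i lt_ji).
by rewrite /ovrel eq_ji ltnn mark_i andbF.
Qed.

Section Enumeration.

Variable A : pred nat.

Definition ov_heads (v n : nat) : seq (nat * bool) :=
  [seq x <- [seq (w, b) | w <- iota 1 v, b <- [:: true; false]]
     | [&& ovrel (v, true) x, A x.1 & x.1 <= n]].

(* The overpartitions of [n] whose parts satisfy [A] and which may follow a
   part equal to [v]; the fuel [f] only has to be at least [n]. *)
Fixpoint ov_enum (f v n : nat) : seq (seq (nat * bool)) :=
  (if n == 0 then [:: [::]] else [::]) ++
  (if f is f'.+1 then
     [seq x :: s | x <- ov_heads v n, s <- ov_enum f' x.1 (n - x.1)]
   else [::]).

Lemma mem_ov_heads v n x :
  (x \in ov_heads v n) = [&& ovrel (v, true) x, A x.1, 0 < x.1 & x.1 <= n].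
Proof.
case: x => w b; rewrite mem_filter /=.
have -> : ((w, b) \in [seq (w, b) | w <- iota 1 v, b <- [:: true; false]])
    = (0 < w <= v).
  apply/allpairsP/idP => [[[w' b']] /= [] + _ [-> _] | wv].
    by rewrite mem_iota; lia.
  by exists (w, b); rewrite mem_iota; case: (b); split => //=; lia.
by rewrite /ovrel /=; case: (A w); case: b; lia.
Qed.

Lemma ov_enum_uniq f v n : uniq (ov_enum f v n).
Proof.
elim: f v n => [|f IHf] v n /=; first by case: eqP.
have uniq_tail : uniq [seq x :: s | x <- ov_heads v n, s <- ov_enum f x.1 (n - x.1)].
  apply: (allpairs_uniq_dep (T := fun=> seq (nat * bool))).
  - apply: filter_uniq; apply: allpairs_uniq; rewrite ?iota_uniq //.
    by move=> [? ?] [? ?] _ _ [-> ->].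
  - by move=> x _; apply: IHf.
  - by move=> [x s] [y t] _ _ /= [-> ->].
case: eqP => //= _; rewrite uniq_tail andbT.
by apply/allpairsPdep => -[x [s []]].
Qed.

Lemma mem_ov_enum f v n s : n <= f ->
  (s \in ov_enum f v n) =
  [&& path ovrel (v, true) s, all (fun x => (0 < x.1) && A x.1) s
    & sumn (unzip1 s) == n].
Proof.
have emptyE m : ([::] \in (if m == 0 then [:: [::]] else [::] : seq (seq (nat * bool))))
    = (0 == m) by case: m.
have consE m x t : (x :: t \in (if m == 0 then [:: [::]] else [::] : seq (seq (nat * bool))))
    = false by case: m.
elim: f v n s => [|f IHf] v n [|x s] le_nf /=; rewrite mem_cat ?emptyE ?consE /=.
- by rewrite orbF.
- by apply/esym/negP => /and3P[_ /andP[/andP[x0 _] _] /eqP]; lia.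
- case: eqP => //= _; by apply/allpairsPdep => -[? [? []]].
apply/allpairsPdep/idP.
  move=> [[w b] [t [yn tn [-> ->]]]]; move: yn tn; rewrite mem_ov_heads /=.
  move=> /and4P[-> Aw w0 wn]; rewrite IHf; last lia.
  move=> /and3P[pt At /eqP sum_t]; rewrite w0 Aw At sum_t subnKC //.
  by rewrite (path_ovrel w b true) pt eqxx.
case: x => w b /= /and3P[/andP[vx px] /andP[/andP[w0 Aw] As] /eqP sum_s].
exists (w, b), s; rewrite mem_ov_heads vx /= Aw w0 IHf ?As; last lia.
rewrite (path_ovrel w true b) px.
by split => //=; lia.
Qed.

End Enumeration.

Lemma Bbar_size_ov_enum l1 l2 n :
  Bbar l1 l2 n =
  size (ov_enum (fun d => ~~ (l1 %| d) && ~~ (l2 %| d)) n n.+1 n).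
Proof.
set A := fun d => _; rewrite /Bbar cardE.
set B := enum _.
pose h (t : {bseq n of 'I_n.+1 * bool}) : seq (nat * bool) :=
  [seq (val x.1, x.2) | x <- t].
rewrite -(size_map h); apply/perm_size/uniq_perm.
- rewrite map_inj_uniq ?enum_uniq // => t u eq_tu; apply: val_inj.
  by apply: (inj_map _ eq_tu) => -[i b] [j c] [/val_inj -> ->].
- exact: ov_enum_uniq.
(* The bound [n.+1] exceeds every part, so it leaves the first part and its mark unrestricted. *)
have headE (s : seq (nat * bool)) : all (fun x => (0 < x.1) && A x.1) s ->
    sumn (unzip1 s) = n -> path ovrel (n.+1, true) s = sorted ovrel s.
  case: s => [|x s] //= _ sum_s; rewrite /ovrel /= (_ : x.1 < n.+1) //; lia.
have AE (s : seq (nat * bool)) : all (fun x => (0 < x.1) && A x.1) s =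
    all (leq 1) (unzip1 s) && all (fun x => A x.1) s.
  by rewrite all_map -all_predI; apply: eq_all.
move=> s; rewrite mem_ov_enum //; apply/mapP/idP.
  move=> [t]; rewrite mem_enum !inE is_overpartitionE => /andP[/and3P[so pos /eqP sum_t] At] ->.
  have Ah : all (fun x => (0 < x.1) && A x.1) (h t).
    by rewrite AE pos all_map.
  by rewrite headE // so Ah sum_t eqxx.
move=> /and3P[ps As /eqP sum_s].
move: ps; rewrite headE // => so.
have : size s <= n /\ all (fun x => x.1 <= n) s.
  move: As; rewrite -sum_s; elim: (s) => [|[w b] u IHu] //= /andP[/andP[w0 _] /IHu[su au]].
  split; first exact: leq_add w0 su.
  by rewrite leq_addr; apply: sub_all au => y /= /leq_trans; apply; apply: leq_addl.
move=> [size_s le_s].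
have size_t : size [seq (inord x.1 : 'I_n.+1, x.2) | x <- s] <= n by rewrite size_map.
have ht : s = h (Bseq size_t).
  rewrite /h /= -map_comp -[LHS]map_id; apply/eq_in_map => -[w b] /(allP le_s) /= wn.
  by rewrite inordK.
exists (Bseq size_t) => //; rewrite mem_enum !inE is_overpartitionE -/(h _) -ht so sum_s eqxx.
move: As; rewrite AE => /andP[-> Aall] /=.
have : all (fun x => A x.1) (h (Bseq size_t)) by rewrite -ht.
by rewrite [X in is_true X -> _]all_map.
Qed.

(** * The generating function as a product of truncated series *)

Local Open Scope ring_scope.

(** A next part below the previous part [v.+1] may be overlined or not, hence the factor 2; a
    repetition of [v.+1] may not be overlined. *)
Lemma size_ov_enumS (A : pred nat) f v n :
  size (ov_enum A f.+1 v.+1 n) =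
  ((n == 0) + \sum_(1 <= w < v.+1 | A w && (w <= n)) 2 * size (ov_enum A f w (n - w))
   + (if A v.+1 && (v.+1 <= n) then size (ov_enum A f v.+1 (n - v.+1)) else 0))%N.
Proof.
have -> : ov_enum A f.+1 v.+1 n = (if n == 0 then [:: [::]] else [::]) ++
  [seq x :: s | x <- ov_heads A v.+1 n, s <- ov_enum A f x.1 (n - x.1)] by [].
rewrite size_cat size_allpairs_dep sumnE big_map big_filter big_mkcond big_allpairs_dep.
rewrite -addnA; congr (_ + _)%N; first by case: eqP.
have -> : iota 1 v.+1 = index_iota 1 v.+2 by rewrite /index_iota subn1.
rewrite big_nat_recr //=; congr (_ + _)%N; last first.
  rewrite !big_cons big_nil /ovrel /= ltnn eqxx /=.
  by rewrite add0n addn0.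
rewrite [RHS]big_mkcond; apply: eq_big_nat => w /andP[w0 wv].
rewrite !big_cons big_nil /ovrel /= wv /=.
by case: (_ && _); lia.
Qed.

Section Coefficients.

Variables (A : pred nat) (N : nat).

Definition part_block (d : nat) : {poly int} :=
  if A d then \sum_(1 <= m < N.+1) 'X^(d * m) else 0.

Definition part_prod (v : nat) : {poly int} :=
  \prod_(1 <= d < v.+1) (1 + 2 * part_block d).

(** A telescoping sum; the term at [w] accounts for the overpartitions with largest part [w],
    matching the recursion of [ov_enum]. *)
Lemma part_prodE v : part_prod v =
  1 + \sum_(1 <= w < v.+1) 2 * (part_prod w.-1 * part_block w).
Proof.
elim: v => [|v IHv]; first by rewrite /part_prod !big_geq // addr0.
rewrite {1}/part_prod big_nat_recr //= -/(part_prod v) big_nat_recr //=.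
rewrite addrA -IHv; ring.
Qed.

(* Truncation of the geometric series at degree [N] is invisible below [N]. *)
Lemma coef_mul_part_block w n (P : {poly int}) : (0 < w)%N -> (n <= N)%N ->
  (P * part_block w)`_n =
  if A w && (w <= n)%N then (P * (1 + part_block w))`_(n - w) else 0.
Proof.
move=> w0 nN; rewrite /part_block; case: (A w); last by rewrite mulr0 coef0.
set S := \sum_(_ <= _ < _) _.
have XS : 'X^w * (1 + S) = S + 'X^(w * N.+1).
  rewrite mulrDr mulr1 /S big_distrr /= -[RHS](big_nat_recr N.+1 1 (fun m => 'X^(w * m))) //.
  rewrite [RHS]big_nat_recl //= muln1; congr (_ + _).
  by apply: eq_bigr => m _; rewrite -exprD mulnS.
have -> : P * S = 'X^w * (P * (1 + S)) - P * 'X^(w * N.+1).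
  by rewrite mulrCA XS; ring.
rewrite coefB coefXnM coefMXn (_ : n < w * N.+1)%N ?subr0; last nia.
by case: ltnP.
Qed.

(** After a part [v.+1], further copies of it carry no mark, so its factor is 1 + g instead of 1 +
    2g; the parts up to [v] keep their full factors. *)
Lemma size_ov_enum f v n : (n <= f)%N -> (n <= N)%N ->
  (size (ov_enum A f v.+1 n))%:Z = (part_prod v * (1 + part_block v.+1))`_n.
Proof.
elim: f v n => [|f IHf] v n nf nN.
  have -> : n = 0%N by lia.
  rewrite mulrDr mulr1 coefD coef_mul_part_block // andbF addr0 part_prodE coefD.
  rewrite coef1 coef_sum big_nat big1 ?addr0 // => w /andP[w0 _].
  by rewrite mulr_natl coefMn coef_mul_part_block // leqNgt w0 andbF mul0rn.
rewrite size_ov_enumS mulrDr mulr1 coefD coef_mul_part_block // !PoszD.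
congr (_ + _); last by case: ifP => // /andP[_ vn]; rewrite IHf //; lia.
rewrite part_prodE coefD coef1 coef_sum; congr (_ + _); first by rewrite natz.
rewrite (big_morph Posz PoszD (erefl _)) big_mkcond; apply: eq_big_nat => w /andP[w0 _].
rewrite mulr_natl coefMn coef_mul_part_block //.
case: ifP => [/andP[_ wn]|_]; last by rewrite mul0rn.
case: w w0 wn => // w _ wn; rewrite PoszM IHf /=; [ring | lia | lia].
Qed.

End Coefficients.

Lemma Bbar_coef l1 l2 n :
  (Bbar l1 l2 n)%:Z =
  (part_prod (fun d => ~~ (l1 %| d)%N && ~~ (l2 %| d)%N) n n)`_n.
Proof.
rewrite Bbar_size_ov_enum (@size_ov_enum _ n) // mulrDr mulr1 coefD.
by rewrite coef_mul_part_block // ltnn andbF addr0.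
Qed.

(** Here [e] is the second elementary symmetric function of the [g i], and [Q] collects the terms of
    degree at least 3. The first equation determines 2[e] without dividing by 2. *)
Lemma prod_1D2_mod8 (R : comNzRingType) (I : Type) (s : seq I) (g : I -> R) :
  exists e Q : R,
    (\sum_(i <- s) g i) ^+ 2 = \sum_(i <- s) g i ^+ 2 + 2 * e /\
    \prod_(i <- s) (1 + 2 * g i) = 1 + 2 * (\sum_(i <- s) g i) + 4 * e + 8 * Q.
Proof.
elim: s => [|i s [e [Q [IHe IHQ]]]].
  by exists 0, 0; rewrite !big_nil; split; ring.
exists (e + g i * \sum_(j <- s) g j), (Q + e * g i + 2 * Q * g i).
rewrite !big_cons IHQ; split; last by ring.
by rewrite sqrrD IHe; ring.
Qed.

(* Parity of divisor counts, and the divisor sum *)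
Local Close Scope ring_scope.

Lemma even_size_involution (T : eqType) (f : T -> T) (s : seq T) :
  uniq s -> {in s, forall x, f x \in s} -> {in s, forall x, f (f x) = x} ->
  {in s, forall x, f x != x} -> ~~ odd (size s).
Proof.
have [n] := ubnP (size s); elim: n s => // n IHn [|x s] //= lt_n.
move=> /andP[xs us] fs ff fx.
have fxs : f x \in s.
  by have := fs x; rewrite !inE eqxx (negbTE (fx x _)) ?inE ?eqxx //=; apply.
have := perm_size (perm_to_rem fxs) => /= size_s.
have remE y : y \in rem (f x) s = (y != f x) && (y \in s) by rewrite mem_rem_uniq.
have in_s y : y \in s -> y \in x :: s by rewrite inE orbC => ->.
rewrite size_s negbK; apply: IHn; first lia.
- exact: rem_uniq.
- move=> y; rewrite !remE => /andP[y_fx ys]; have /= := fs y (in_s _ ys).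
  have fyfx : f y != f x.
    apply: contraNneq xs => e; rewrite -(ff x) ?mem_head // -e ff //; exact: in_s.
  rewrite inE fyfx => /orP[/eqP e|->//].
  by move: y_fx; rewrite -e ff ?eqxx //; apply: in_s.
- by move=> y; rewrite remE => /andP[_ ys]; apply: ff; apply: in_s.
- by move=> y; rewrite remE => /andP[_ ys]; apply: fx; apply: in_s.
Qed.

(** A fixed point of d -> n / d would make n a square, and no square is 2 modulo 3. *)
Lemma size_divisors_even n : n %% 3 = 2 -> ~~ odd (size (divisors n)).
Proof.
move=> n3; have n0 : 0 < n by case: n n3.
apply: (@even_size_involution _ (fun d => n %/ d)).
- exact: divisors_uniq.
- by move=> d; rewrite -!dvdn_divisors //; apply: dvdn_div.
- by move=> d; rewrite -dvdn_divisors // => dn; rewrite divnA ?mulKn.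
move=> d; rewrite -dvdn_divisors // => dn; apply/eqP => nd.
have n_eq : n = d * d by rewrite -{1}(divnK dn) nd.
have : d * d %% 3 = 2 by rewrite -n_eq.
by rewrite -modnMm; case: (d %% 3) (ltn_pmod d (isT : 0 < 3)) => [|[|[|]]].
Qed.

Definition part29 (d : nat) : bool := ~~ (2 %| d) && ~~ (9 %| d).

Lemma size_part29_divisors_even n : 0 < n -> 3 %| n ->
  ~~ odd (size (filter part29 (divisors n))).
Proof.
move=> n0 n3.
(* Since 9 does not divide an admissible d, the exponent of 3 in d is 0 or 1, and the map swaps
   these two values. *)
apply: (@even_size_involution _ (fun d => if 3 %| d then d %/ 3 else 3 * d)).
- exact/filter_uniq/divisors_uniq.
- move=> d; rewrite !mem_filter -!dvdn_divisors // /part29 => /andP[Ad dn].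
  case: ifPn => d3.
    rewrite (dvdn_trans _ dn) ?dvdn_div // andbT; lia.
  rewrite (Gauss_dvd _ (_ : coprime 3 d)) ?prime_coprime // n3 dn !andbT; lia.
- move=> d; rewrite mem_filter => /andP[/andP[_ d9] _].
  have [d3|_] := boolP (3 %| d); last by rewrite dvdn_mulr // mulKn.
  by rewrite (_ : (3 %| d %/ 3) = false); lia.
- move=> d; rewrite mem_filter -dvdn_divisors // => /andP[_ dn].
  have := dvdn_gt0 n0 dn; case: ifPn; lia.
Qed.

Lemma dvdn_part29 n d : n %% 2 = 1 -> n %% 3 != 0 -> d %| n -> part29 d.
Proof.
move=> n2 n3 dn; apply/andP; split; apply/negP => /dvdn_trans /(_ dn); first lia.
by move=> n9; move: n3; rewrite -/(3 %| n) (dvdn_trans _ n9).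
Qed.

Definition sigma (n : nat) : nat := \sum_(d <- divisors n) d.

Lemma odd_sigma n : odd n -> odd (sigma n) = odd (size (divisors n)).
Proof.
move=> on; have n0 : 0 < n by case: n on.
have : {in divisors n, forall d, odd d}.
  by move=> d; rewrite -dvdn_divisors // => /dvdn_odd; apply.
rewrite /sigma; elim: (divisors n) => [|d s IHs] os; first by rewrite big_nil.
rewrite big_cons oddD os ?mem_head //= IHs // => x xs.
by apply: os; rewrite inE xs orbT.
Qed.

Lemma sigma_divn n : 0 < n -> sigma n = \sum_(d <- divisors n) n %/ d.
Proof.
move=> n0; rewrite /sigma -(big_map (fun d => n %/ d) xpredT id).
have divK : {in divisors n, forall d, n %/ (n %/ d) = d}.
  by move=> d; rewrite -dvdn_divisors // => dn; rewrite divnA ?mulKn.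
apply/perm_big/uniq_perm; first exact: divisors_uniq.
  rewrite map_inj_in_uniq ?divisors_uniq // => d e dn en eq_de.
  by rewrite -(divK d) // eq_de divK.
have inv d : d \in divisors n -> n %/ d \in divisors n.
  by rewrite -!dvdn_divisors //; apply: dvdn_div.
move=> d; apply/idP/mapP => [dn|[e en ->]]; last exact: inv.
by exists (n %/ d); rewrite ?divK ?inv.
Qed.

(** The divisors of pm that are multiples of p sum to p [sigma] m. The remaining divisors are the
    same for m = n and m = pn, so they cancel when the two splittings are subtracted. *)
Lemma sigma_hecke p n : prime p -> 0 < n ->
  sigma (p * (p * n)) + p * sigma n = (p + 1) * sigma (p * n).
Proof.
move=> pr_p n0; have p0 := prime_gt0 pr_p.
have multE m : 0 < m -> \sum_(d <- divisors (p * m) | p %| d) d = p * sigma m.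
  move=> m0; rewrite /sigma big_distrr /= -big_filter.
  rewrite -(big_map (fun d => p * d) xpredT id).
  apply/perm_big/uniq_perm; first exact/filter_uniq/divisors_uniq.
    by rewrite map_inj_uniq ?divisors_uniq // => d e /eqP; rewrite eqn_pmul2l // => /eqP.
  move=> d; rewrite mem_filter -dvdn_divisors ?muln_gt0 ?p0 //.
  apply/andP/mapP => [[/dvdnP[e ->]]|[e em ->]].
    by rewrite mulnC dvdn_pmul2l // => em; exists e; rewrite -?dvdn_divisors.
  by rewrite dvdn_mulr // dvdn_pmul2l // dvdn_divisors.
have pn0 : 0 < p * n by rewrite muln_gt0 p0.
have coE : \sum_(d <- divisors (p * (p * n)) | ~~ (p %| d)) d =
           \sum_(d <- divisors (p * n) | ~~ (p %| d)) d.
  rewrite -!(big_filter _ (fun d => ~~ (p %| d))).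
  apply/perm_big/uniq_perm; try exact/filter_uniq/divisors_uniq.
  move=> d; rewrite !mem_filter -!dvdn_divisors ?muln_gt0 ?p0 //.
  case pd: (p %| d) => //=.
  by rewrite Gauss_dvdr // coprime_sym prime_coprime // pd.
have sigmaE m : 0 < m -> sigma (p * m) =
    p * sigma m + \sum_(d <- divisors (p * m) | ~~ (p %| d)) d.
  by move=> m0; rewrite -multE // {1}/sigma (bigID (fun d => p %| d)).
have := sigmaE _ pn0; have := sigmaE _ n0; rewrite coE; lia.
Qed.

(** * Coefficients of the product modulo 8 *)

Local Open Scope ring_scope.

Lemma coef_part_block A N d i : (0 < d)%N -> (i <= N)%N ->
  (part_block A N d)`_i = [&& A d, d %| i & 0 < i]%N%:R.
Proof.
move=> d0; have [n] := ubnP i; elim: n i => // n IHn i lt_i iN.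
(* With P = 1 the shift lemma passes from degree i to i - d, where the induction hypothesis
   applies. *)
rewrite -[part_block _ _ _]mul1r coef_mul_part_block // mul1r coefD coef1.
case Ad: (A d) => //=; case: (leqP d i) => di; last first.
  by case: i di {lt_i iN} => [|i] di; rewrite ?ltnn ?andbF // gtnNdvd.
have i0 := leq_trans d0 di; rewrite IHn ?Ad; [|lia|lia].
rewrite dvdn_subl // i0 andbT subn_eq0 subn_gt0 /=.
case: ltngtP di => // [di _|-> _]; first by rewrite add0r andbT.
by rewrite dvdnn andbF.
Qed.

Lemma coef_part_block_sum A N i : (0 < i <= N)%N ->
  (\sum_(1 <= d < N.+1) part_block A N d)`_i =
  (size (filter A (divisors i)))%:R.
Proof.
move=> /andP[i0 iN]; rewrite coef_sum.
under eq_big_nat => d /andP[d0 _] do rewrite coef_part_block // i0 andbT.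
rewrite -natr_sum; congr (_%:R).
transitivity (count (fun d => A d && (d %| i)%N) (index_iota 1 N.+1)).
  by rewrite -sum1_count [RHS]big_mkcond; apply: eq_bigr => d _; case: (_ && _).
rewrite -size_filter; apply/perm_size/uniq_perm.
- exact/filter_uniq/iota_uniq.
- exact/filter_uniq/divisors_uniq.
move=> d; rewrite !mem_filter mem_index_iota -dvdn_divisors // -andbA.
case: (A d) => //=; case di: (d %| i)%N => //=.
by have := dvdn_gt0 i0 di; have := dvdn_leq i0 di; lia.
Qed.

(** The coefficient counts the i strictly between 0 and N with d dividing both i and N - i; if d
    divides N these are the N / d multiples of d up to N, less N itself. *)
Lemma coef_part_block_sqr A N d : (0 < d)%N -> (0 < N)%N ->
  (part_block A N d ^+ 2)`_N =
  (if A d && (d %| N)%N then (N %/ d).-1 else 0)%:R.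
Proof.
move=> d0 N0; rewrite expr2 coefM.
under eq_bigr => i _ do
  rewrite !coef_part_block ?leq_subr ?(leq_ord i) // -natrM mulnb.
rewrite -natr_sum; congr (_%:R).
case: (A d) => /=; last by rewrite big1.
rewrite -(big_mkord xpredT (fun i : nat =>
  ((d %| i) && (0 < i) && ((d %| N - i) && (0 < N - i)))%N : nat)).
rewrite big_ltn // andbF add0n big_nat_recr //= subnn andbF andbF addn0.
case: ifPn => dN; last first.
  rewrite big_nat big1 // => i /andP[i0 iN].
  by case di: (d %| i)%N => //=; rewrite dvdn_subl ?(ltnW iN) // (negbTE dN) andbF.
transitivity (\sum_(1 <= i < N) (d %| i))%N.
  apply: eq_big_nat => i /andP[i0 iN]; rewrite i0 andbT.
  by case di: (d %| i)%N => //=; rewrite dvdn_sub // subn_gt0 iN.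
by rewrite divn_count_dvd big_nat_recr //= dN addn1.
Qed.

(** The number of terms is even, so the reflection has no middle term and the sum is twice a sum of
    even numbers. *)
Lemma dvd4_sum_sym (F : nat -> nat) h :
  (forall i, (i <= h.*2.+1)%N -> F i = F (h.*2.+1 - i)%N) ->
  (forall i, (i <= h.*2.+1)%N -> ~~ odd (F i)) ->
  (4 %| \sum_(0 <= i < h.*2.+2) F i)%N.
Proof.
move=> Fsym Feven; rewrite (big_cat_nat (n := h.+1)) //=; last lia.
have -> : (\sum_(h.+1 <= i < h.*2.+2) F i = \sum_(0 <= i < h.+1) F i)%N.
  rewrite -{1}[h.+1]add0n big_addn (_ : h.*2.+2 - h.+1 = h.+1)%N; last lia.
  rewrite big_nat_rev /=; apply: eq_big_nat => i /andP[_ ih].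
  by rewrite [RHS]Fsym; [congr F; lia | lia].
rewrite addnn -muln2 (@dvdn_pmul2r 2 2) // big_nat.
by apply: dvdn_sum => i /andP[_ ih]; rewrite dvdn2 Feven //; lia.
Qed.

Lemma Bbar29_mod8 N : (N %% 6 = 1)%N ->
  exists z : int, (Bbar 2 9 N)%:Z = 2 * (sigma N)%:Z + 8 * z.
Proof.
move=> N6; have N0 : (0 < N)%N by case: N N6.
have allA d : (d %| N)%N -> part29 d by apply: dvdn_part29; lia.
rewrite Bbar_coef -/part29 /part_prod.
have [e [Q [sqE ->]]] := prod_1D2_mod8 (index_iota 1 N.+1) (part_block part29 N).
move: sqE; set G := \sum_(_ <- _) _ => sqE.
(* [G] has no constant term, so the value at 0 is set by hand rather than read off [divisors 0]. *)
pose c i := if i == 0%N then 0%N else size (filter part29 (divisors i)).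
have Gc i : (i <= N)%N -> G`_i = (c i)%:R.
  move=> iN; rewrite /c; case: eqP => [->|/eqP]; last first.
    by rewrite -lt0n => i0; apply: coef_part_block_sum; rewrite i0.
  rewrite coef_sum big_nat big1 // => d /andP[d0 _].
  by rewrite coef_part_block // !andbF.
have cN : c N = size (divisors N).
  rewrite /c gtn_eqF //; congr size; apply/all_filterP/allP => d.
  by rewrite -dvdn_divisors //; apply: allA.
have G2 : exists k : nat, (G ^+ 2)`_N = (4 * k)%N%:R.
  rewrite expr2 coefM.
  under eq_bigr => i _ do rewrite !Gc ?leq_subr ?(leq_ord i) // -natrM.
  rewrite -natr_sum -(big_mkord xpredT (fun i => c i * c (N - i))%N).
  suff /dvdnP[k ->] : (4 %| \sum_(0 <= i < N.+1) c i * c (N - i))%N.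
    by exists k; rewrite mulnC.
  have NE : N = (N./2).*2.+1 by lia.
  rewrite {1}NE; apply: dvd4_sum_sym; rewrite -NE => i iN.
    by rewrite mulnC subKn.
  have c3 j : (3 %| j)%N -> ~~ odd (c j).
    rewrite /c; case: eqP => // /eqP; rewrite -lt0n.
    exact: size_part29_divisors_even.
  (* Such a j is prime to 6, so all its divisors are admissible and [c j] is the full divisor
     count. *)
  have c2 j : odd j -> (j %% 3 = 2)%N -> ~~ odd (c j).
    move=> oj j3; rewrite /c; case: eqP => // /eqP; rewrite -lt0n => j0.
    rewrite (_ : filter _ _ = divisors j) ?size_divisors_even //.
    apply/all_filterP/allP => d; rewrite -dvdn_divisors //.
    by apply: dvdn_part29; lia.
  rewrite oddM negb_and.
  have [i3|/negbTE i3] := boolP (3 %| i)%N; first by rewrite c3.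
  have [j3|/negbTE j3] := boolP (3 %| N - i)%N; first by rewrite (c3 (N - i)%N) ?orbT.
  have [oi|/negbTE oi] := boolP (odd i); first by rewrite (c2 i) //; lia.
  by rewrite (c2 (N - i)%N) ?orbT //; lia.
have [k kE] := G2.
have sumsq : (\sum_(1 <= d < N.+1) part_block part29 N d ^+ 2)`_N =
    (sigma N)%:Z - (size (divisors N))%:Z.
  rewrite coef_sum.
  under eq_big_nat => d /andP[d0 _] do rewrite coef_part_block_sqr //.
  rewrite -natr_sum -big_mkcond natz.
  have -> : (\sum_(1 <= d < N.+1 | part29 d && (d %| N)) (N %/ d).-1 =
             \sum_(d <- divisors N) (N %/ d).-1)%N.
    rewrite -big_filter; apply/perm_big/uniq_perm.
    - exact/filter_uniq/iota_uniq.
    - exact: divisors_uniq.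
    move=> d; rewrite mem_filter mem_index_iota -dvdn_divisors //.
    case dN: (d %| N)%N; last by rewrite andbF.
    by rewrite allA //= (dvdn_gt0 N0 dN) ltnS dvdn_leq.
  suff -> : sigma N = (\sum_(d <- divisors N) (N %/ d).-1 + size (divisors N))%N by lia.
  rewrite sigma_divn // -sum1_size -big_split /= big_seq [RHS]big_seq.
  apply: eq_bigr => d; rewrite -dvdn_divisors // => dN.
  by rewrite addn1 prednK // divn_gt0 ?(dvdn_gt0 N0 dN) // dvdn_leq.
(* Solving for the coefficient of [e] turns 2 tau + 4 [e] into 4 tau - 2 [sigma] modulo 8. As N is
   odd, tau and [sigma] have the same parity, so 4 tau may be replaced by 4 [sigma]. *)
have := congr1 (fun P : {poly int} => P`_N) sqE.
rewrite /= kE coefD sumsq mulr_natl coefMn => e2.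
rewrite !coefD coef1 !mulr_natl !coefMn Gc // cN gtn_eqF //.
have := odd_sigma (_ : odd N) => /(_ ltac:(lia)) par.
have [t tE] : exists t : int, (size (divisors N))%:Z = (sigma N)%:Z + 2 * t.
  exists (((size (divisors N))./2)%:Z - ((sigma N)./2)%:Z).
  by rewrite -{1}(odd_double_half (size _)) -{1}(odd_double_half (sigma N)) par; lia.
exists (Q`_N + k%:Z + t).
move: e2 tE; rewrite !natz.
have mulrnE (x : int) (m : nat) : x *+ m = x * m%:Z by rewrite -mulr_natr natz.
rewrite !mulrnE PoszM.
move: (e`_N) (Q`_N) (size _) (sigma N) => e' Q' u v; lia.
Qed.

(* The congruence between the values at p^2 N and N *)
Local Close Scope ring_scope.

Theorem theorem3p4 (k p r : nat) (hk : (0 < k)%N) (hp : prime p)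
    (hp6 : p = 5 %[mod 6]) (hr : (p %| 6 * r + 5)%N) (n : nat) :
  ((Bbar 2 9 (6 * p ^ k.+1 * n + 6 * p * r + 5 * p)%N)%:Z
    = - p%:Z * (Bbar 2 9 (6 * p ^ k.-1 * n + (6 * r + 5) %/ p)%N)%:Z
      %[mod 8])%Z.
Proof.
case: k hk => // k _ /=.
have [q qE] : exists q, (6 * r + 5 = q * p)%N by apply/dvdnP.
have p0 := prime_gt0 hp.
set N := (6 * p ^ k * n + (6 * r + 5) %/ p)%N.
have NE : N = (6 * (p ^ k * n) + q)%N by rewrite /N qE mulnK // mulnA.
have -> : (6 * p ^ k.+2 * n + 6 * p * r + 5 * p = p * (p * N))%N.
  have -> : (6 * p ^ k.+2 * n + 6 * p * r + 5 * p =
             6 * p ^ k.+2 * n + p * (6 * r + 5))%N by ring.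
  by rewrite qE NE !expnS; ring.
have p6 : (p %% 6 = 5)%N by rewrite hp6.
(* From 5q = 5 modulo 6, where 5 is invertible. *)
have q6 : (q %% 6 = 1)%N.
  have : (q * p = 5 %[mod 6])%N by rewrite -qE; lia.
  rewrite -modnMm p6.
  by case: (q %% 6)%N (ltn_pmod q (isT : (0 < 6)%N)) => [|[|[|[|[|[|]]]]]].
have N6 : (N %% 6 = 1)%N by rewrite NE; lia.
have N0 : (0 < N)%N by case: (N) N6.
have pN6 : (p * N %% 6 = 5)%N by rewrite -modnMm p6 N6.
have ppN6 : (p * (p * N) %% 6 = 1)%N by rewrite -modnMm p6 pN6.
have [z ->] := Bbar29_mod8 ppN6; have [y ->] := Bbar29_mod8 N6.
have pN_odd : odd (p * N) by lia.
have sigma_even : ~~ odd (sigma (p * N)).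
  by rewrite odd_sigma // size_divisors_even //; lia.
have [a aE] : exists a, sigma (p * N) = (2 * a)%N.
  by exists (sigma (p * N))./2; lia.
have [b bE] : exists b, (p + 1 = 2 * b)%N by exists ((p + 1)./2); lia.
have sE : ((sigma (p * (p * N)))%:Z = (2 * b * (2 * a))%N%:Z - p%:Z * (sigma N)%:Z)%R.
  by rewrite -bE -aE -sigma_hecke // PoszD PoszM addrK.
apply/eqP; rewrite eqz_mod_dvd; apply/dvdzP.
(* The two sides differ by 2([sigma] (p^2 N) + p [sigma] N) + 8z + 8py, and the first term is
   2(2b)(2a) = 8ab. *)
exists (z + p%:Z * y + a%:Z * b%:Z)%R; rewrite sE !PoszM; ring.
Qed.
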